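(* Let $\Omega\subset\mathbb{R}^n$ be a bounded domain, $2\le n<p\le\infty$, let $\alpha_p=\frac{n-1}{p-1}$ and $C_p=\frac{p}{p+n-2}$ for $p<\infty$, and $\alpha_\infty=0$, $C_\infty=1$. Let $f\in\mathcal{C}(\Omega)$, $g\in\mathcal{C}^{0,1-\alpha_p}(\partial\Omega)$, and let $u\in\mathcal{C}(\overline\Omega)$ be a viscosity solution of $$-\Delta_p^N u=f\ \text{ in }\Omega,\qquad u=g\ \text{ on }\partial\Omega .$$ Then for every $x,y\in\overline\Omega$ with $x\ne y$, $$\frac{|u(x)-u(y)|}{|x-y|^{1-\alpha_p}}\le C_p\,\|f\|_{L^\infty(\Omega)}\,{\rm diam}(\Omega)^{1+\alpha_p}+[g]_{1-\alpha_p,\partial\Omega}.$$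
   Context: $[g]_{\gamma,\partial\Omega}=\sup_{x\ne y\in\partial\Omega}\frac{|g(x)-g(y)|}{|x-y|^{\gamma}}$ is the Hölder seminorm. For a symmetric matrix $X$, $M(X)$ and $m(X)$ are its greatest and smallest eigenvalues. Where $\nabla\varphi\ne0$: $\Delta_\infty^N\varphi=\big\langle D^2\varphi\frac{\nabla\varphi}{|\nabla\varphi|},\frac{\nabla\varphi}{|\nabla\varphi|}\big\rangle$ and, for $p<\infty$, $\Delta_p^N\varphi=\frac1p|\nabla\varphi|^{2-p}{\rm div}(|\nabla\varphi|^{p-2}\nabla\varphi)=\frac1p\Delta\varphi+\frac{p-2}{p}\Delta_\infty^N\varphi$. Viscosity solutions (for $2<p\le\infty$): a continuous $u$ is a viscosity solution of $-\Delta_p^N u=f$ in $\Omega$ if it is a sub- and a supersolution, i.e. for all $x_0\in\Omega$ and $\varphi\in\mathcal{C}^2(\Omega)$: (sub) if $u-\varphi$ has a local maximum at $x_0$, then $-\Delta_p^N\varphi(x_0)\le f(x_0)$ if $\nabla\varphi(x_0)\ne0$, while if $\nabla\varphi(x_0)=0$ then $-\frac1p\Delta\varphi(x_0)-\frac{p-2}pM(D^2\varphi(x_0))\le f(x_0)$ when $p<\infty$, and $-M(D^2\varphi(x_0))\le f(x_0)$ when $p=\infty$; (super) if $u-\varphi$ has a local minimum at $x_0$, then $-\Delta_p^N\varphi(x_0)\ge f(x_0)$ if $\nabla\varphi(x_0)\ne0$, while if $\nabla\varphi(x_0)=0$ then $-\frac1p\Delta\varphi(x_0)-\frac{p-2}pm(D^2\varphi(x_0))\ge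 f(x_0)$ when $p<\infty$, and $-m(D^2\varphi(x_0))\ge f(x_0)$ when $p=\infty$. If $f$ is unbounded, $\|f\|_{L^\infty(\Omega)}=+\infty$ and the estimate is trivial. *)

(* Defs.v *)
From HB Require Import structures.
From mathcomp Require Import all_boot all_order all_algebra.
From mathcomp Require Import all_classical all_reals all_analysis.

Set Implicit Arguments.
Unset Strict Implicit.
Unset Printing Implicit Defensive.

Import Order.TTheory GRing.Theory Num.Theory.
Import numFieldNormedType.Exports.

Local Open Scope classical_set_scope.
Local Open Scope ring_scope.

(* The library norm on 'rV[R]_n is the sup norm: it induces the usual topology
   and the usual bounded sets, but all the metric quantities below use the
   Euclidean norm. *)
Definition enorm (R : realType) (n : nat) (x : 'rV[R]_n) : R :=
  Num.sqrt (\sum_(i < n) x 0 i ^+ 2).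

Definition diam (R : realType) (n : nat) (A : set 'rV[R]_n) : R :=
  sup [set r : R | exists x y, [/\ A x, A y & r = enorm (x - y)]].

Definition boundary (T : topologicalType) (A : set T) : set T :=
  closure A `\` interior A.

Definition bounded_domain (R : realType) (n : nat) (A : set 'rV[R]_n) : Prop :=
  [/\ open A, connected A, A !=set0 & bounded_set A].

Definition holder_seminorm (R : realType) (n : nat) (gamma : R)
    (A : set 'rV[R]_n) (g : 'rV[R]_n -> R) : \bar R :=
  ereal_sup [set r : \bar R | exists x y,
    [/\ A x, A y, x != y &
        r = (`|g x - g y| / (enorm (x - y) `^ gamma))%:E]].

(* Membership in C^{0,gamma}(A) for a bounded set A, where finiteness of the
   seminorm already implies that g is bounded. *)
Definition holder (R : realType) (n : nat) (gamma : R)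
    (A : set 'rV[R]_n) (g : 'rV[R]_n -> R) : Prop :=
  (holder_seminorm gamma A g < +oo)%E.

(* Lebesgue-null subsets of R^n: the library has no Lebesgue measure on
   'rV[R]_n, so nullity is expressed by countable covers by boxes of
   arbitrarily small total volume. *)
Definition lebesgue_null (R : realType) (n : nat) (A : set 'rV[R]_n) : Prop :=
  forall e : R, 0 < e ->
  exists a b : nat -> 'rV[R]_n,
    [/\ forall k i, a k 0 i <= b k 0 i,
        A `<=` \bigcup_k [set x | forall i, a k 0 i <= x 0 i <= b k 0 i] &
        (\sum_(0 <= k <oo) (\prod_(i < n) (b k 0 i - a k 0 i))%:E <= e%:E)%E].

Definition Linfty_norm (R : realType) (n : nat) (A : set 'rV[R]_n)
    (f : 'rV[R]_n -> R) : \bar R :=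
  ereal_inf [set M : \bar R | (0 <= M)%E /\
    lebesgue_null [set x | A x /\ (M < `|f x|%:E)%E]].

Definition partial (R : realType) (n : nat) (i : 'I_n)
    (phi : 'rV[R]_n -> R) (x : 'rV[R]_n) : R :=
  'D_(delta_mx 0 i) phi x.

Definition C1_on (R : realType) (n : nat) (A : set 'rV[R]_n)
    (phi : 'rV[R]_n -> R) : Prop :=
  {within A, continuous phi} /\
  forall i : 'I_n, (forall x, A x -> derivable phi x (delta_mx 0 i)) /\
                   {within A, continuous (partial i phi)}.

Definition C2_on (R : realType) (n : nat) (A : set 'rV[R]_n)
    (phi : 'rV[R]_n -> R) : Prop :=
  C1_on A phi /\ forall i : 'I_n, C1_on A (partial i phi).

Definition grad (R : realType) (n : nat) (phi : 'rV[R]_n -> R)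
    (x : 'rV[R]_n) : 'rV[R]_n :=
  \row_i partial i phi x.

Definition hessian (R : realType) (n : nat) (phi : 'rV[R]_n -> R)
    (x : 'rV[R]_n) : 'M[R]_n :=
  \matrix_(i, j) partial j (partial i phi) x.

Definition laplacian (R : realType) (n : nat) (phi : 'rV[R]_n -> R)
    (x : 'rV[R]_n) : R :=
  \tr (hessian phi x).

Definition max_eigenvalue (R : realType) (n : nat) (X : 'M[R]_n) : R :=
  sup [set a : R | eigenvalue X a].

Definition min_eigenvalue (R : realType) (n : nat) (X : 'M[R]_n) : R :=
  inf [set a : R | eigenvalue X a].

Definition inf_laplacianN (R : realType) (n : nat) (phi : 'rV[R]_n -> R)
    (x : 'rV[R]_n) : R :=
  let nu := (enorm (grad phi x))^-1 *: grad phi x in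
  (nu *m hessian phi x *m nu^T) 0 0.

(* For p in ]2, +oo], with p : \bar R; the value at p = -oo is never used. *)

(* (1/p) Laplacian + ((p-2)/p) lambda for finite p, and lambda for p = +oo. *)
Definition p_combine (R : realType) (n : nat) (p : \bar R)
    (phi : 'rV[R]_n -> R) (x : 'rV[R]_n) (lambda : R) : R :=
  match p with
  | EFin q => q^-1 * laplacian phi x + (q - 2) / q * lambda
  | _ => lambda
  end.

(* Meaningful where the gradient of phi does not vanish; for finite p this is
   the expanded form of p^-1 |grad phi|^(2-p) div(|grad phi|^(p-2) grad phi). *)
Definition p_laplacianN (R : realType) (n : nat) (p : \bar R)
    (phi : 'rV[R]_n -> R) (x : 'rV[R]_n) : R :=
  p_combine p phi x (inf_laplacianN phi x).

Definition viscosity_subsolution (R : realType) (n : nat) (p : \bar R)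
    (A : set 'rV[R]_n) (f u : 'rV[R]_n -> R) : Prop :=
  forall (x0 : 'rV[R]_n) (phi : 'rV[R]_n -> R), A x0 -> C2_on A phi ->
    (\forall x \near x0, u x - phi x <= u x0 - phi x0) ->
    (grad phi x0 != 0 -> - p_laplacianN p phi x0 <= f x0) /\
    (grad phi x0 = 0 ->
      - p_combine p phi x0 (max_eigenvalue (hessian phi x0)) <= f x0).

Definition viscosity_supersolution (R : realType) (n : nat) (p : \bar R)
    (A : set 'rV[R]_n) (f u : 'rV[R]_n -> R) : Prop :=
  forall (x0 : 'rV[R]_n) (phi : 'rV[R]_n -> R), A x0 -> C2_on A phi ->
    (\forall x \near x0, u x0 - phi x0 <= u x - phi x) ->
    (grad phi x0 != 0 -> f x0 <= - p_laplacianN p phi x0) /\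
    (grad phi x0 = 0 ->
      f x0 <= - p_combine p phi x0 (min_eigenvalue (hessian phi x0))).

Definition viscosity_solution (R : realType) (n : nat) (p : \bar R)
    (A : set 'rV[R]_n) (f u : 'rV[R]_n -> R) : Prop :=
  [/\ {within A, continuous u}, viscosity_subsolution p A f u &
      viscosity_supersolution p A f u].

Definition alpha_ (R : realType) (n : nat) (p : \bar R) : R :=
  match p with
  | EFin q => (n%:R - 1) / (q - 1)
  | _ => 0
  end.

Definition C_ (R : realType) (n : nat) (p : \bar R) : R :=
  match p with
  | EFin q => q / (q + n%:R - 2)
  | _ => 1
  end.

(* Main.v *)
Require Import Defs.
From mathcomp Require Import all_boot all_order all_algebra.
From mathcomp Require Import all_classical all_reals all_analysis.
From mathcomp Require Import measurable_realfun ring lra.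
Import Order.TTheory GRing.Theory Num.Theory.
Import numFieldNormedType.Exports.
Local Open Scope classical_set_scope.
Local Open Scope ring_scope.

(* The function [u] is compared with the barriers
   [w z = A |z| ^ (1 - alpha) - B |z| ^ 2].  Away from the origin the first term
   is p-harmonic, so [- Delta_p^N w = 2 B / C_p], which exceeds [f] as soon as
   [2 B > C_p ||f||].  Comparing with the barrier centred at a boundary point
   bounds [|u x - u y|] for [y] on the boundary, at the cost of an additional
   [B diam ^ (1 + alpha)] in the Hoelder constant; this makes the comparison
   with the barrier centred at an arbitrary [y] possible, at the same cost.
   Finally [2 B] tends to [C_p ||f||].

   The gradient of [w] may vanish on a sphere, where the definition of a
   subsolution is too weak to contradict [- Delta_p^N w > f].  This is avoided by
   maximizing [u x - w (x - y - h)] over [x] and over small shifts [h]: at a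
   maximum point the shift minimizes [w (x - y - h)], whereas the critical
   sphere of [w] consists of its global maxima. *)

(** * One-variable estimates *)

(** [t ^ a = exp (a ln t)] is at least [1 + a ln t], and [ln t <= t - 1] is reversed by the factor
    [a <= 0]. *)
Lemma powR_ge_tangent {R : realType} (a t : R) :
  a <= 0 -> 0 < t -> 1 + a * (t - 1) <= t `^ a.
Proof.
move=> a0 t0; rewrite /powR gt_eqF//.
apply: le_trans (expR_ge1Dx _).
have : ln t <= t - 1 by rewrite -{1}(subrK 1 t) addrC le_ln1Dx//; lra.
by move=> h; rewrite lerD2l; apply: ler_wnM2l.
Qed.

(** Both sides of 1 are treated together: the sign of [(c - 1) * (t - 1)] records that [c] lies on
    the same side of 1 as [t]. *)
Lemma MVT_at1 {R : realType} {f f' : R -> R} {t : R} : 0 < t -> t != 1 ->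
  (forall s : R, 0 < s -> is_derive s 1 f (f' s)) -> f 1 = 0 ->
  exists c, [/\ 0 < c, 0 < (c - 1) * (t - 1) & f t = f' c * (t - 1)].
Proof.
move=> t0 t1 df f1.
have cf a b : 0 < a -> {within `[a, b], continuous f}.
  move=> a0; apply: derivable_within_continuous => x.
  by rewrite in_itv/= => /andP[ax _]; apply: ex_derive; apply: df; lra.
have [lt1|gt1|e] := ltgtP t 1; last by rewrite e eqxx in t1.
- have d x : x \in `]t, 1[ -> is_derive x 1 f (f' x).
    by rewrite in_itv/= => /andP[tx _]; apply: df; lra.
  have [c] := MVT lt1 d (cf _ _ t0).
  by rewrite in_itv/= f1 => /andP[tc c1] e; exists c; split; [lra|nra|lra].
- have d x : x \in `]1, t[ -> is_derive x 1 f (f' x).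
    by rewrite in_itv/= => /andP[tx _]; apply: df; lra.
  have [c] := MVT gt1 d (cf _ _ ltr01).
  by rewrite in_itv/= f1 => /andP[tc c1] e; exists c; split; [lra|nra|lra].
Qed.

Lemma sign_of_derive_le0 {R : realType} {f f' : R -> R} {t : R} :
  (forall s : R, 0 < s -> is_derive s 1 f (f' s)) -> f 1 = 0 ->
  (forall s : R, 0 < s -> f' s <= 0) -> 0 < t -> (t - 1) * f t <= 0.
Proof.
move=> df f1 f'0 t0; have [->|t1] := eqVneq t 1; first by rewrite f1 mulr0.
have [c [c0 _ ->]] := MVT_at1 t0 t1 df f1.
by rewrite mulrCA -expr2 mulr_le0_ge0 ?sqr_ge0 ?f'0.
Qed.

(** [f] is nondecreasing up to 1 and nonincreasing afterwards, so [f 1 = 0] is its maximum. Together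
    with the preceding lemma, a sign of the second derivative becomes a sign of the function. *)
Lemma le0_of_derive_sign {R : realType} {f f' : R -> R} {t : R} :
  (forall s : R, 0 < s -> is_derive s 1 f (f' s)) -> f 1 = 0 ->
  (forall s : R, 0 < s -> (s - 1) * f' s <= 0) -> 0 < t -> f t <= 0.
Proof.
move=> df f1 f'0 t0; have [->|t1] := eqVneq t 1; first by rewrite f1.
have [c [c0 h ->]] := MVT_at1 t0 t1 df f1.
rewrite leNgt; apply/negP => /(mulr_gt0 h).
have -> : (c - 1) * (t - 1) * (f' c * (t - 1)) = (c - 1) * f' c * (t - 1) ^+ 2.
  by ring.
by rewrite ltNge mulr_le0_ge0 ?sqr_ge0 ?f'0.
Qed.

(** The form power minus polynomial is stable under differentiation, so Taylor remainders can be
    differentiated repeatedly. *)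
Lemma is_derive_powR_horner {R : realType} (k b : R) (p : {poly R}) (s : R) :
  0 < s ->
  is_derive s 1 (fun t => k * t `^ b - p.[t]) (k * b * s `^ (b - 1) - p^`().[s]).
Proof.
move=> s0; have dp : is_derive s 1 (horner p) p^`().[s].
  rewrite [_.[s]](congr1 (@^~ s) (derive.derivE p)) derive1E.
  exact/derivableP/derivable_horner.
have -> : (fun t => k * t `^ b - p.[t]) = k *: (@powR R ^~ b) - horner p.
  by apply/funext.
have dq := is_derive1_powR b s0.
by apply: is_derive_eq; rewrite -mulrA.
Qed.

Lemma powR_le_tangent {R : realType} (b t : R) :
  0 <= b <= 1 -> 0 < t -> t `^ b <= 1 + b * (t - 1).
Proof.
move=> /andP[b0 b1] t0.
pose p : {poly R} := 1 + b *: ('X - 1).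
have d2 (s : R) : 0 < s -> is_derive s 1 (fun t => 1 * b * t `^ (b - 1) - p^`().[t])
    (b * (b - 1) * s `^ (b - 1 - 1)).
  move=> s0; have := is_derive_powR_horner (1 * b) (b - 1) p^`() s s0.
  by move=> h; apply: is_derive_eq; rewrite !poly.derivE !hornerE; ring.
have : 1 * t `^ b - p.[t] <= 0.
  apply: (@le0_of_derive_sign _ (fun t => 1 * t `^ b - p.[t])
    (fun t => 1 * b * t `^ (b - 1) - p^`().[t])) => [s|||//].
  - exact: is_derive_powR_horner.
  - by rewrite powR1 !hornerE; ring.
  - move=> s; apply: (@sign_of_derive_le0 _ (fun t => 1 * b * t `^ (b - 1) - p^`().[t])
     _ _ d2).
      by rewrite powR1 !poly.derivE !hornerE; ring.
    move=> r r0; rewrite mulrC; apply: mulr_ge0_le0; rewrite ?powR_ge0//.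
    by nra.
by rewrite !hornerE; lra.
Qed.

(** The second derivative of the remainder is [b * (b - 1) <= 0] times the gap between [s ^ (b - 2)]
    and its tangent at 1, which is nonnegative. Integrating twice from 1 gives the sign of the
    remainder. *)
Lemma powR_le_cubic {R : realType} (b t : R) : 0 <= b <= 1 -> 0 < t ->
  t `^ b <= 1 + b * (t - 1) + b * (b - 1) / 2 * (t - 1) ^+ 2
            + b * (b - 1) * (b - 2) / 6 * (t - 1) ^+ 3.
Proof.
move=> /andP[b0 b1] t0.
pose p : {poly R} := 1 + b *: ('X - 1) + (b * (b - 1) / 2) *: ('X - 1) ^+ 2
  + (b * (b - 1) * (b - 2) / 6) *: ('X - 1) ^+ 3.
have : 1 * t `^ b - p.[t] <= 0.
  apply: (@le0_of_derive_sign _ (fun t => 1 * t `^ b - p.[t])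
    (fun t => 1 * b * t `^ (b - 1) - p^`().[t])) => [s|||//].
  - exact: is_derive_powR_horner.
  - by rewrite powR1 !hornerE/=; ring.
  - move=> s; apply: (@sign_of_derive_le0 _ (fun t => 1 * b * t `^ (b - 1) - p^`().[t])
     (fun t => 1 * b * (b - 1) * t `^ (b - 1 - 1) - p^`()^`().[t])) => [r||].
    + exact: is_derive_powR_horner.
    + by rewrite powR1 !poly.derivE !hornerE/=; ring.
    + move=> r r0.
      have := @powR_ge_tangent R (b - 1 - 1) r _ r0.
      move=> /(_ ltac:(lra)) h.
      rewrite (_ : p^`()^`().[r] = b * (b - 1) * (1 + (b - 1 - 1) * (r - 1))).
        by rewrite mul1r -mulrBr mulr_le0_ge0 ?subr_ge0//; nra.
      by rewrite !poly.derivE !hornerE/=; field.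
by rewrite !hornerE/=; lra.
Qed.

(** * Radial polynomials *)

(** Polynomials in the squared norm are smooth at the centre too, unlike polynomials in the norm. *)
Definition sqnorm {R : realType} {n : nat} (x : 'rV[R]_n) : R :=
  \sum_(i < n) x 0 i ^+ 2.

Lemma sqnorm_ge0 {R : realType} {n : nat} (x : 'rV[R]_n) : 0 <= sqnorm x.
Proof. by apply: sumr_ge0 => i _; exact: sqr_ge0. Qed.

Lemma sqnorm_eq0 {R : realType} {n : nat} (x : 'rV[R]_n) :
  (sqnorm x == 0) = (x == 0).
Proof.
rewrite psumr_eq0 => [|i _]; last exact: sqr_ge0.
apply/allP/eqP => [h|-> i _]; last by rewrite /= mxE expr0n.
apply/rowP => i; rewrite mxE; apply/eqP.
by have := h i (mem_index_enum i); rewrite /= sqrf_eq0.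
Qed.

Lemma continuous_sqnorm {R : realType} {n : nat} :
  continuous (@sqnorm R n).
Proof.
apply: continuous_big => [|i _ x].
  exact: add_continuous.
apply: (@continuous_comp _ _ _ (fun x : 'rV[R]_n => x 0 i) (fun t => t ^+ 2)).
  exact: coord_continuous.
exact: exprn_continuous.
Qed.

Lemma is_derive_coord {R : realType} {n : nat} (i : 'I_n) (x v : 'rV[R]_n) :
  is_derive x v (fun y : 'rV[R]_n => y 0 i) (v 0 i).
Proof.
split; first exact/diff_derivable/differentiable_coord.
have := derive_id x v; rewrite derive_mx => [/matrixP/(_ 0 i)|].
  by rewrite mxE.
exact: derivable_id.
Qed.

Lemma is_derive_sqnormB {R : realType} {n : nat} (z x v : 'rV[R]_n) :
  is_derive x v (fun y : 'rV[R]_n => sqnorm (y - z))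
    (2 * \sum_(i < n) (x - z) 0 i * v 0 i).
Proof.
have -> : (fun y : 'rV[R]_n => sqnorm (y - z)) =
    \sum_(i < n) ((fun y : 'rV[R]_n => y 0 i) - cst (z 0 i)) ^+ 2.
  apply/funext => y; rewrite fct_sumE; apply: eq_bigr => i _.
  by rewrite !mxE.
have d (i : 'I_n) := is_derive_coord i x v.
apply: is_derive_eq.
rewrite mulr_sumr; apply: eq_bigr => i _; rewrite !mxE subr0 expr1 mulrA.
by [].
Qed.

Lemma is_derive_horner_comp {R : realType} {n : nat} (p : {poly R})
    (f : 'rV[R]_n -> R) (x v : 'rV[R]_n) (df : R) :
  is_derive x v f df -> is_derive x v (fun y : 'rV[R]_n => p.[f y]) (p^`().[f x] * df).
Proof.
move=> d; elim/poly_ind: p => [|p c IH].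
  rewrite (_ : (fun _ => _) = cst 0); last by apply/funext => y; rewrite horner0.
  by rewrite deriv0 horner0 mul0r; exact: is_derive_cst.
rewrite (_ : (fun _ => _) = (fun y : 'rV[R]_n => p.[f y]) * f + cst c); last first.
  by apply/funext => y; rewrite !hornerE.
apply: is_derive_eq; rewrite !poly.derivE !hornerE/=.
rewrite -![_ *: _]/(_ * _); ring.
Qed.

Lemma is_derive_radial {R : realType} {n : nat} (p : {poly R})
    (z x : 'rV[R]_n) (i : 'I_n) :
  is_derive x (delta_mx 0 i) (fun y : 'rV[R]_n => p.[sqnorm (y - z)])
    (p^`().[sqnorm (x - z)] * (2 * (x - z) 0 i)).
Proof.
have d := is_derive_sqnormB z x (delta_mx 0 i).
apply: is_derive_eq (is_derive_horner_comp p _ _ _ _ d) _.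
congr (_ * (_ * _)); rewrite (bigD1 i)//= big1 => [|j ji].
  by rewrite [delta_mx _ _ _ _]mxE !eqxx mulr1 addr0.
by rewrite [delta_mx _ _ _ _]mxE (negPf ji) andbF mulr0.
Qed.

Lemma partial_radial {R : realType} {n : nat} (p : {poly R})
    (z : 'rV[R]_n) (i : 'I_n) :
  partial i (fun y : 'rV[R]_n => p.[sqnorm (y - z)]) =
  (fun x : 'rV[R]_n => p^`().[sqnorm (x - z)] * (2 * (x - z) 0 i)).
Proof.
apply/funext => x.
exact: (@derive_val _ _ _ _ _ _ _ (is_derive_radial p z x i)).
Qed.

Lemma is_derive_partial_radial {R : realType} {n : nat} (p : {poly R})
    (z x : 'rV[R]_n) (i j : 'I_n) :
  is_derive x (delta_mx 0 j) (partial i (fun y : 'rV[R]_n => p.[sqnorm (y - z)]))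
    (4 * p^`()^`().[sqnorm (x - z)] * (x - z) 0 i * (x - z) 0 j
     + 2 * p^`().[sqnorm (x - z)] * (i == j)%:R).
Proof.
rewrite partial_radial.
have d1 := is_derive_radial p^`() z x j.
have d2 : is_derive x (delta_mx 0 j) (fun y : 'rV[R]_n => (y - z) 0 i) (i == j)%:R.
  have d := is_deriveB (is_derive_coord i x (delta_mx 0 j))
    (is_derive_cst (z 0 i) x (delta_mx 0 j)).
  rewrite [X in is_derive _ _ X](_ : _ = (fun y : 'rV[R]_n => y 0 i) - cst (z 0 i));
    last by apply/funext => y; rewrite !mxE.
  by apply: is_derive_eq d _; rewrite subr0 mxE eqxx.
apply: is_derive_eq (is_deriveM d1 (is_deriveZ 2 d2)) _.
have ringE (a b c d e : R) :
  a * (2 * e) + 2 * c * (b * (2 * d)) = 4 * b * c * d + 2 * a * e by ring.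
exact: ringE.
Qed.

Lemma continuous_radial {R : realType} {n : nat} (p : {poly R}) (z : 'rV[R]_n) :
  continuous (fun y : 'rV[R]_n => p.[sqnorm (y - z)]).
Proof.
move=> x; apply: (@continuous_comp _ _ _ (fun y : 'rV[R]_n => sqnorm (y - z)) (horner p));
  last exact: continuous_horner.
apply: (@continuous_comp _ _ _ (fun y : 'rV[R]_n => y - z) sqnorm);
  last exact: continuous_sqnorm.
exact: (@continuousB _ _ _ id (cst z) x (@cvg_id _ _) (@cst_continuous _ _ z x)).
Qed.

Lemma continuous_coordB {R : realType} {n : nat} (z : 'rV[R]_n) (i : 'I_n) :
  continuous (fun y : 'rV[R]_n => (y - z) 0 i).
Proof.
move=> x; apply: (@continuous_comp _ _ _ (fun y : 'rV[R]_n => y - z)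
  (fun y : 'rV[R]_n => y 0 i));
  last exact: coord_continuous.
exact: (@continuousB _ _ _ id (cst z) x (@cvg_id _ _) (@cst_continuous _ _ z x)).
Qed.

Lemma C2_on_radial {R : realType} {n : nat} (A : set 'rV[R]_n) (p : {poly R})
    (z : 'rV[R]_n) :
  C2_on A (fun y : 'rV[R]_n => p.[sqnorm (y - z)]).
Proof.
have cM (f g : 'rV[R]_n -> R) : continuous f -> continuous g ->
    continuous (fun y => f y * g y).
  by move=> cf cg y; apply: continuousM; [exact: cf|exact: cg].
have cD (f g : 'rV[R]_n -> R) : continuous f -> continuous g ->
    continuous (fun y => f y + g y).
  by move=> cf cg y; apply: continuousD; [exact: cf|exact: cg].
have cst_c (c : R) : continuous (fun _ : 'rV[R]_n => c) by exact: cst_continuous.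
have c1 i : continuous (partial i (fun y : 'rV[R]_n => p.[sqnorm (y - z)])).
  rewrite partial_radial; apply: (cM); first exact: continuous_radial.
  by apply: (cM); [exact: cst_c|exact: continuous_coordB].
split=> [|i]; split.
- exact/continuous_subspaceT/continuous_radial.
- move=> i; split=> [x _|]; last exact/continuous_subspaceT/c1.
  by apply: ex_derive; exact: is_derive_radial.
- exact/continuous_subspaceT/c1.
- move=> j; split=> [x _|].
    by apply: ex_derive; exact: is_derive_partial_radial.
  apply: continuous_subspaceT.
  have -> : partial j (partial i (fun y : 'rV[R]_n => p.[sqnorm (y - z)])) =
      (fun x : 'rV[R]_n => 4 * p^`()^`().[sqnorm (x - z)] * (x - z) 0 i * (x - z) 0 j
     + 2 * p^`().[sqnorm (x - z)] * (i == j)%:R).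
    apply/funext => x.
    exact: (@derive_val _ _ _ _ _ _ _ (is_derive_partial_radial p z x i j)).
  apply: (cD); apply: (cM); try exact: cst_c.
  - apply: (cM); last exact: continuous_coordB.
    by apply: (cM); [exact: cst_c|exact: continuous_radial].
  - exact: continuous_coordB.
  - by apply: (cM); [exact: cst_c|exact: continuous_radial].
Qed.

Lemma grad_radial {R : realType} {n : nat} (p : {poly R}) (z x : 'rV[R]_n) :
  grad (fun y : 'rV[R]_n => p.[sqnorm (y - z)]) x
  = (2 * p^`().[sqnorm (x - z)]) *: (x - z).
Proof.
by apply/rowP => i; rewrite mxE partial_radial [RHS]mxE; ring.
Qed.

Lemma hessian_radial {R : realType} {n : nat} (p : {poly R}) (z x : 'rV[R]_n) :
  hessian (fun y : 'rV[R]_n => p.[sqnorm (y - z)]) x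
  = (4 * p^`()^`().[sqnorm (x - z)]) *: ((x - z)^T *m (x - z))
    + (2 * p^`().[sqnorm (x - z)])%:M.
Proof.
apply/matrixP => i j; rewrite mxE.
rewrite [LHS](@derive_val _ _ _ _ _ _ _ (is_derive_partial_radial p z x i j)).
rewrite !mxE big_ord1 !mxE; ring.
Qed.

Lemma mulmx_trE {R : realType} {n : nat} (x : 'rV[R]_n) :
  x *m x^T = (sqnorm x)%:M.
Proof.
apply/matrixP => i j; rewrite !ord1 mxE [RHS]mxE mulr1n.
by apply: eq_bigr => k _; rewrite mxE expr2.
Qed.

Lemma quad_form_rank1_scalar {R : realType} {n : nat} (a b k : R) (v : 'rV[R]_n) :
  ((k *: v) *m (b *: (v^T *m v) + a%:M) *m (k *: v)^T) 0 0
  = k ^+ 2 * sqnorm v * (b * sqnorm v + a).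
Proof.
have -> : (k *: v)^T = k *: v^T by apply/matrixP => i j; rewrite !mxE.
rewrite mulmxDr mulmxDl mul_mx_scalar linearZ/=.
rewrite -!scalemxAl -!scalemxAr !mulmxA mulmx_trE.
rewrite mul_scalar_mx -!scalemxAl mulmx_trE.
rewrite !mxE/= !mulr1n; ring.
Qed.

Lemma laplacian_radial {R : realType} {n : nat} (p : {poly R}) (z x : 'rV[R]_n) :
  laplacian (fun y : 'rV[R]_n => p.[sqnorm (y - z)]) x
  = 4 * p^`()^`().[sqnorm (x - z)] * sqnorm (x - z)
    + 2 * n%:R * p^`().[sqnorm (x - z)].
Proof.
rewrite /laplacian hessian_radial mxtraceD mxtraceZ mxtrace_mulC mulmx_trE.
by rewrite !mxtrace_scalar mulr1n -mulr_natr; ring.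
Qed.

Lemma inf_laplacianN_radial {R : realType} {n : nat} (p : {poly R}) (z x : 'rV[R]_n) :
  grad (fun y : 'rV[R]_n => p.[sqnorm (y - z)]) x != 0 ->
  inf_laplacianN (fun y : 'rV[R]_n => p.[sqnorm (y - z)]) x
  = 4 * p^`()^`().[sqnorm (x - z)] * sqnorm (x - z)
    + 2 * p^`().[sqnorm (x - z)].
Proof.
rewrite /inf_laplacianN grad_radial hessian_radial.
set a := 2 * _; set b := 4 * _; set v := x - z; set s := sqnorm v.
rewrite scaler_eq0 negb_or => /andP[a0 v0].
set c := (enorm _)^-1.
(* The vector [(c * a) *: v] is the unit gradient direction. *)
have cs : (c * a) ^+ 2 * s = 1.
  rewrite exprMn /c exprVn /enorm sqr_sqrtr ?sumr_ge0// => [|i _]; last exact: sqr_ge0.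
  have -> : \sum_(i < n) (a *: v) 0 i ^+ 2 = a ^+ 2 * s.
    by rewrite mulr_sumr; apply: eq_bigr => i _; rewrite mxE exprMn.
  have s0 : s != 0 by rewrite sqnorm_eq0.
  by field; rewrite a0 s0.
by rewrite scalerA quad_form_rank1_scalar cs mul1r.
Qed.

(** * Barriers *)

(** Homogeneity reduces the bound to [s0 = 1]. *)
Lemma powR_scaled_le_cubic {R : realType} (b s0 s : R) :
  0 <= b <= 1 -> 0 < s0 -> 0 < s ->
  s `^ b <= s0 `^ b * (1 + b * (s / s0 - 1) + b * (b - 1) / 2 * (s / s0 - 1) ^+ 2
            + b * (b - 1) * (b - 2) / 6 * (s / s0 - 1) ^+ 3).
Proof.
move=> b01 s00 s_gt0.
have t0 : 0 < s / s0 by rewrite divr_gt0.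
have {1}-> : s = s0 * (s / s0) by rewrite mulrC divfK// gt_eqF.
by rewrite powRM ?(ltW s00) ?(ltW t0)// ler_wpM2l ?powR_ge0// powR_le_cubic.
Qed.

(* Test functions must be C2 on the whole domain, which may contain the singular
   point of the barrier: the barrier, as a function of the squared norm, is
   replaced by a polynomial that touches it from above with the same first and
   second derivatives.  Stopping at the cubic Taylor term makes the bound global. *)
Lemma barrier_majorant {R : realType} (A B b s0 : R) :
  0 <= b <= 1 -> 0 <= A -> 0 < s0 ->
  exists p : {poly R},
    [/\ p.[s0] = A * s0 `^ b - B * s0,
        p^`().[s0] = A * b * (s0 `^ b / s0) - B,
        p^`()^`().[s0] = A * b * (b - 1) * (s0 `^ b / s0 ^+ 2) &
        forall s, 0 < s -> A * s `^ b - B * s <= p.[s]].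
Proof.
move=> b01 A0 s00.
have s0n : s0 != 0 by rewrite gt_eqF.
pose q : {poly R} := s0^-1 *: 'X - 1.
pose p : {poly R} := (A * s0 `^ b) *: (1 + b *: q + (b * (b - 1) / 2) *: q ^+ 2
  + (b * (b - 1) * (b - 2) / 6) *: q ^+ 3) - B *: 'X.
exists p; split.
- by rewrite /p /q !hornerE/= mulVf//; ring.
- by rewrite /p /q !poly.derivE !hornerE/= mulVf//; ring.
- by rewrite /p /q !poly.derivE !hornerE/= mulVf//; field.
- move=> s s_gt0; rewrite /p /q !hornerE/= lerD2r.
  apply: le_trans (ler_wpM2l A0 (powR_scaled_le_cubic _ _ _ b01 s00 s_gt0)) _.
  by rewrite le_eqVlt; apply/orP; left; apply/eqP; field.
Qed.

(** In the ratio of norms [r = sqrt (s / s0)] the power becomes [r ^ (2 b)] with [2 b <= 1], which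
    lies below its tangent at 1. The critical equation then turns the hypothesis into
    [B * s0 * (r - 1) ^ 2 <= 0]. *)
Lemma barrier_strict_max {R : realType} (A B b s0 s : R) :
  0 < b <= 2^-1 -> 0 <= A -> 0 < B -> 0 < s0 -> 0 <= s ->
  A * b * (s0 `^ b / s0) - B = 0 ->
  A * s0 `^ b - B * s0 <= A * s `^ b - B * s -> s = s0.
Proof.
move=> /andP[b0 b2] A0 B0 s00 s_ge0 crit.
have s0n : s0 != 0 by rewrite gt_eqF.
pose r := Num.sqrt (s / s0).
have r0 : 0 <= r by exact: sqrtr_ge0.
have rE : s = s0 * r ^+ 2 by rewrite /r sqr_sqrtr ?divr_ge0 ?(ltW s00)// [RHS]mulrC divfK.
have sb : s `^ b <= s0 `^ b * (1 + 2 * b * (r - 1)).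
  rewrite {1}rE powRM ?sqr_ge0 ?(ltW s00)//; apply: ler_wpM2l; first exact: powR_ge0.
  rewrite -powR_mulrn// -powRrM.
  (* The tangent bound is for positive [r]; at [r = 0] it reads [0 <= 1 - 2 b]. *)
  move: r0; rewrite le_eqVlt => /orP[/eqP<-|r0].
    by rewrite powR0 ?mulf_neq0 ?gt_eqF//; lra.
  by apply: powR_le_tangent => //; apply/andP; split; lra.
have e : A * s0 `^ b * b = B * s0.
  by move/eqP: crit; rewrite subr_eq0 => /eqP <-; field.
move=> h.
have h2 := ler_wpM2l A0 sb.
have h3 : A * (s0 `^ b * (1 + 2 * b * (r - 1))) =
    A * s0 `^ b + 2 * (A * s0 `^ b * b) * (r - 1).
  by ring.
rewrite h3 e in h2; rewrite {2}rE in h.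
have : B * s0 * (r - 1) ^+ 2 <= 0 by nra.
rewrite pmulr_rle0 ?mulr_gt0// => h4.
have : (r - 1) ^+ 2 == 0 by rewrite eq_le h4 sqr_ge0.
by rewrite sqrf_eq0 subr_eq0 => /eqP r1; rewrite rE r1 expr1n mulr1.
Qed.

(** Differentiability gives continuity where [f] is positive; near a zero of [f],
    [f y < e ^ (1 / b)] forces [f y ^ b < e]. *)
Lemma continuous_powR_comp {R : realType} {T : topologicalType} (b : R) (f : T -> R) :
  0 < b -> (forall x, 0 <= f x) -> continuous f ->
  continuous (fun x => f x `^ b).
Proof.
move=> b0 f0 cf x.
have := f0 x; rewrite le_eqVlt => /orP[/eqP fx|fx].
  apply/cvgrPdist_lt => e e0; rewrite -fx powR0 ?gt_eqF//.
  have e1 : 0 < e `^ b^-1 by rewrite powR_gt0.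
  have : \forall y \near x, f y < e `^ b^-1.
    by have := cvgr_lt (f x) (cf x) (e `^ b^-1); rewrite -fx; apply.
  apply: filterS => y fy; rewrite sub0r normrN ger0_norm ?powR_ge0//.
  have := gt0_ltr_powR b0 (f0 y) (powR_ge0 _ _) fy.
  by rewrite -powRrM mulVf ?gt_eqF// powRr1 // ltW.
apply: (@continuous_comp _ _ _ f (fun t => t `^ b)); first exact: cf.
apply: differentiable_continuous; apply/derivable1_diffP.
by have d := is_derive1_powR b fx; apply: ex_derive.
Qed.

(** The power is applied to the squared norm, so [b] stands for half of the Hoelder exponent
    [1 - alpha_ n p]. *)
Definition barrier {R : realType} {n : nat} (A B b : R) (z : 'rV[R]_n) : R :=
  A * sqnorm z `^ b - B * sqnorm z.

Lemma continuous_barrier {R : realType} {n : nat} (A B b : R) :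
  0 < b -> continuous (@barrier R n A B b).
Proof.
move=> b0 x.
apply: (@continuousB _ _ _ (fun z : 'rV[R]_n => A * sqnorm z `^ b)
  (fun z => B * sqnorm z)).
  apply: (@continuousM _ _ (cst A) (fun z : 'rV[R]_n => sqnorm z `^ b)).
    exact: cst_continuous.
  by apply: continuous_powR_comp => //; [exact: sqnorm_ge0|exact: continuous_sqnorm].
apply: (@continuousM _ _ (cst B) (@sqnorm R n)); first exact: cst_continuous.
exact: continuous_sqnorm.
Qed.

Lemma C_gt0 {R : realType} {n : nat} {p : \bar R} :
  (2 <= n)%N -> (n%:R%:E < p)%E -> 0 < C_ n p.
Proof.
move=> n2; have : 2 <= n%:R :> R by rewrite ler_nat.
by case: p => [q||]//= n2R; rewrite lte_fin => nq; rewrite divr_gt0; lra.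
Qed.

Lemma alpha_bounds {R : realType} {n : nat} {p : \bar R} :
  (2 <= n)%N -> (n%:R%:E < p)%E -> 0 <= alpha_ n p < 1.
Proof.
move=> n2; have : 2 <= n%:R :> R by rewrite ler_nat.
case: p => [q||]//= n2R; last by rewrite lexx ltr01.
rewrite lte_fin => nq; rewrite divr_ge0/=; [|lra|lra].
by rewrite ltr_pdivrMr; lra.
Qed.

(* With [b = (1 - alpha) / 2], the function [z |-> |z| ^ (1 - alpha)] is
   p-harmonic away from the origin, so only the quadratic part contributes. *)
Lemma p_laplacianN_barrier {R : realType} {n : nat} {p : \bar R}
    {q : {poly R}} {A B E : R} {z x : 'rV[R]_n} :
  (2 <= n)%N -> (n%:R%:E < p)%E ->
  let b := (1 - alpha_ n p) / 2 in
  let s := sqnorm (x - z) in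
  q^`().[s] = A * b * (E / s) - B ->
  q^`()^`().[s] = A * b * (b - 1) * (E / s ^+ 2) ->
  grad (fun y => q.[sqnorm (y - z)]) x != 0 ->
  p_laplacianN p (fun y => q.[sqnorm (y - z)]) x = - (2 * B / C_ n p).
Proof.
move=> n2 np b s q1 q2 g0.
have s0 : s != 0.
  apply: contraNneq g0 => /eqP; rewrite sqnorm_eq0 grad_radial => /eqP ->.
  by rewrite scaler0.
rewrite /p_laplacianN inf_laplacianN_radial// /p_combine laplacian_radial -/s q1 q2.
rewrite /b {b q1 q2 g0}; have : 2 <= n%:R :> R by rewrite ler_nat.
case: p np => [r|_|]//= ; last by move=> _; field.
rewrite lte_fin => nr n2R.
field; rewrite s0/=; apply/and3P; split; apply: lt0r_neq0; lra.
Qed.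

(** * Comparison with barriers *)

(** Shifts range over a cube because its coordinates can be changed independently; it is a product
    of compact intervals. *)
Lemma compact_cube {R : realType} (n : nat) (d : R) :
  compact [set h : 'rV[R]_n | forall i, h 0 i \in `[- d, d]].
Proof.
by apply: (@rV_compact _ _ (fun=> [set` `[- d, d]])) => i; exact: segment_compact.
Qed.

Lemma near_cube {R : realType} {n : nat} (P : 'rV[R]_n -> Prop) :
  (\forall h \near (0 : 'rV[R]_n), P h) ->
  exists2 d : R, 0 < d & forall h : 'rV[R]_n, (forall i, h 0 i \in `[- d, d]) -> P h.
Proof.
move=> /nbhs_ballP[e /= e0 eP].
exists (e / 2) => [|h hd]; first by rewrite divr_gt0.
apply: eP; rewrite -ball_normE /= sub0r normrN.
rewrite (le_lt_trans (y := e / 2)) //; last by lra.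
rewrite [leLHS]/Num.Def.normr/= mx_normrE; apply: bigmax_le; first by lra.
move=> [i j] _ /=; have := hd j; rewrite ord1 /= in_itv/= => /andP[? ?].
by rewrite ler_norml; apply/andP.
Qed.

(** Joint continuity gives the bound near each [(x, 0)]; compactness of [Q] makes the size of the
    shift uniform. *)
Lemma barrier_modulus {R : realType} {n : nat} (A B b m : R) (Q : set 'rV[R]_n)
    (y : 'rV[R]_n) :
  0 < b -> compact Q -> 0 < m ->
  \forall h \near (0 : 'rV[R]_n), forall x, Q x ->
    barrier A B b (x - y) - barrier A B b (x - y - h) < m.
Proof.
move=> b0 /compact_near_coveringP cQ m0.
have := cQ 'rV[R]_n (nbhs (0 : 'rV[R]_n)) (fun h x =>
  barrier A B b (x - y) - barrier A B b (x - y - h) < m) _.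
apply=> x _.
pose G (xh : 'rV[R]_n * 'rV[R]_n) :=
  barrier A B b (xh.1 - y) - barrier A B b (xh.1 - y - xh.2).
have cf : (xh.1 - y) @[xh --> (x, 0 : 'rV[R]_n)] --> x - y.
  by apply: cvgB; [exact: cvg_fst|exact: cvg_cst].
have ch : (xh.1 - y - xh.2) @[xh --> (x, 0 : 'rV[R]_n)] --> x - y - 0.
  by apply: cvgB cf _; exact: cvg_snd.
have cG : G xh @[xh --> (x, 0 : 'rV[R]_n)] -->
    barrier A B b (x - y) - barrier A B b (x - y - 0).
  apply: cvgB; (apply: continuous_cvg; first exact: continuous_barrier).
    exact: cf.
  exact: ch.
have := cvgr_lt _ cG m; rewrite subr0 subrr => /(_ _ m0).
exact.
Qed.

Lemma continuous_within_prodB {R : realType} {T S : topologicalType}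
    (Q : set T) (D : set S) (u : T -> R) (W : T * S -> R) :
  {within Q, continuous u} -> continuous W ->
  {within Q `*` D, continuous (fun xh => u xh.1 - W xh)}.
Proof.
move=> /subspace_continuousP cu cW.
apply/subspace_continuousP => -[x h] [/= Qx Dh].
have FF : Filter (within (Q `*` D) (nbhs (x, h))) by exact: within_filter.
have cu' : u xh.1 @[xh --> within (Q `*` D) (nbhs (x, h))] --> u x.
  apply: cvg_comp (cu x Qx) => P /= wP.
  have H : nbhs (x, h) (fun z : T * S => Q z.1 -> P z.1) :=
    @cvg_fst T S (nbhs x) (nbhs h) (nbhs_filter h) _ wP.
  change (nbhs (x, h) (fun z => (Q `*` D) z -> P z.1)).
  by apply: filterS H => -[a c] /= Ha [Qa _]; exact: Ha.
apply: (@cvgB _ _ _ _ FF _ _ _ _ cu').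
exact: cvg_within_filter (cW (x, h)).
Qed.

(* Only radial polynomial test functions with nonvanishing gradient are needed,
   which makes the notion symmetric under [u |-> - u]. *)
Definition radial_subsolution {R : realType} {n : nat} (p : \bar R)
    (Omega : set 'rV[R]_n) (K : R) (u : 'rV[R]_n -> R) : Prop :=
  forall (q : {poly R}) (z x0 : 'rV[R]_n),
    let phi y := q.[sqnorm (y - z)] in
    Omega x0 -> (\forall x \near x0, u x - phi x <= u x0 - phi x0) ->
    grad phi x0 != 0 -> - p_laplacianN p phi x0 <= K.

Lemma barrier0 {R : realType} {n : nat} (A B b : R) :
  0 < b -> barrier A B b (0 : 'rV[R]_n) = 0.
Proof.
move=> b0; have /eqP s0 : sqnorm (0 : 'rV[R]_n) == 0 by rewrite sqnorm_eq0.
by rewrite /barrier s0 powR0 ?gt_eqF// !mulr0 subrr.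
Qed.

(* A critical point [v - h] would be a strict radial maximum of the barrier, so
   every other admissible shift would keep [|v - h|] unchanged; moving one
   coordinate of [h] to [- d], [0] and [d] shows that this is impossible. *)
Lemma barrier_minimizer_noncritical {R : realType} {n : nat} {A B b d : R}
    {v h : 'rV[R]_n} :
  0 < b <= 2^-1 -> 0 <= A -> 0 < B -> 0 < d -> v - h != 0 ->
  (forall i, h 0 i \in `[- d, d]) ->
  (forall h' : 'rV[R]_n, (forall i, h' 0 i \in `[- d, d]) ->
    barrier A B b (v - h) <= barrier A B b (v - h')) ->
  A * b * (sqnorm (v - h) `^ b / sqnorm (v - h)) - B != 0.
Proof.
move=> b02 A0 B0 d0 vh0 hd hmin.
set s0 := sqnorm (v - h).
have s0_gt0 : 0 < s0 by rewrite lt0r sqnorm_ge0 sqnorm_eq0 vh0.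
apply/negP => /eqP crit.
have eqs (h' : 'rV[R]_n) : (forall i, h' 0 i \in `[- d, d]) -> sqnorm (v - h') = s0.
  move=> h'd; apply: barrier_strict_max b02 A0 B0 s0_gt0 (sqnorm_ge0 _) crit _.
  exact: hmin.
have [i vhi] : exists i, (v - h) 0 i != 0.
  apply/existsP; rewrite -negb_forall; apply: contra vh0 => /forallP vh.
  by apply/eqP/rowP => i; rewrite [RHS]mxE; apply/eqP; exact: vh.
pose k t : 'rV[R]_n := \row_j (if j == i then t else h 0 j).
have kd t : t \in `[- d, d] -> forall j, k t 0 j \in `[- d, d].
  by move=> td j; rewrite mxE; case: ifP.
have ks t : sqnorm (v - k t) =
    (v 0 i - t) ^+ 2 + \sum_(j < n | j != i) (v 0 j - h 0 j) ^+ 2.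
  rewrite /sqnorm (bigD1 i)//= !mxE eqxx; congr (_ + _).
  by apply: eq_bigr => j /negPf ji; rewrite !mxE ji.
have [dN dP d0'] : [/\ - d \in `[- d, d], d \in `[- d, d] & 0 \in `[- d, d]].
  by rewrite !in_itv/= !lexx oppr_le0 ge0_cp ?ltW.
move: (eqs _ (kd _ dN)) (eqs _ (kd _ dP)) (eqs _ (kd _ d0')).
rewrite !ks; set S := \sum_(_ < _ | _) _ => e1 e2 e3.
have : 0 < d * d by exact: mulr_gt0.
by move: e1 e2 e3; rewrite !expr2; lra.
Qed.

(** A violation by [m > 0] at [x1] forces a large maximum of the shifted difference at some
    [(xh, h)]. Small shifts keep [xh] off the boundary and off the singularity; there the polynomial
    majorant is a test function with [- p_laplacianN] equal to [2 * B / C_ n p], above [K]. *)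
Lemma barrier_comparison {R : realType} {n : nat} {p : \bar R}
    {Omega : set 'rV[R]_n} {u : 'rV[R]_n -> R} {K A B : R} {y : 'rV[R]_n} :
  (2 <= n)%N -> (n%:R%:E < p)%E -> open Omega -> compact (closure Omega) ->
  {within closure Omega, continuous u} ->
  radial_subsolution p Omega K u ->
  0 <= A -> 0 < B -> K < 2 * B / C_ n p -> closure Omega y ->
  let b := (1 - alpha_ n p) / 2 in
  (forall x, boundary Omega x -> u x - u y <= barrier A B b (x - y)) ->
  forall x, closure Omega x -> u x - u y <= barrier A B b (x - y).
Proof.
move=> n2 np oO cQ cu usub A0 B0 KB Qy b ubd x1 Qx1.
have b02 : 0 < b <= 2^-1.
  have /andP[a0 a1] := alpha_bounds n2 np.
  by rewrite /b; apply/andP; split; lra.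
have /andP[b0 b2] := b02.
rewrite leNgt; apply/negP => viol.
pose m := u x1 - u y - barrier A B b (x1 - y).
have m0 : 0 < m by rewrite subr_gt0.
(* This will exclude [xh = y + h], the point where the shifted barrier is singular and vanishes. *)
have near_y : \forall h \near (0 : 'rV[R]_n),
    closure Omega (y + h) -> u (y + h) < u y + m.
  move/subspace_continuousP : cu => /(_ y Qy) /cvgr_lt /(_ (u y + m)).
  rewrite ltrDl => /(_ m0) near_y.
  have yh : y + h @[h --> (0 : 'rV[R]_n)] --> y.
    rewrite -[X in _ --> X]addr0.
    exact: (@continuousD _ _ _ (cst y) id 0 (@cst_continuous _ _ y 0) (@cvg_id _ _)).
  exact: yh near_y.
have [d d0 dP] := near_cube _ (filterI near_y
  (barrier_modulus A B b m (closure Omega) y b0 cQ m0)).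
pose D := [set h : 'rV[R]_n | forall i, h 0 i \in `[- d, d]].
have D0 : D 0 by move=> i; rewrite mxE in_itv/= oppr_le0 ltW.
have cF : {within closure Omega `*` D,
    continuous (fun xh => u xh.1 - barrier A B b (xh.1 - y - xh.2))}.
  apply: continuous_within_prodB => // xh.
  apply: continuous_cvg; first exact: continuous_barrier.
  by apply: cvgB; [apply: cvgB; [exact: cvg_fst|exact: cvg_cst]|exact: cvg_snd].
have [|[xh h]] := compact_EVT_max _ (compact_setX cQ (compact_cube n d)) cF.
  by exists (x1, 0).
rewrite inE /= => -[Qxh Dh] Fmax.
have {}Fmax x h' : closure Omega x -> D h' ->
    u x - barrier A B b (x - y - h') <= u xh - barrier A B b (xh - y - h).
  by move=> Qx Dh'; apply: (Fmax (x, h')); rewrite inE.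
(* The competitor is [(x1, 0)], the violation without shift. *)
have big : u y + m <= u xh - barrier A B b (xh - y - h).
  by have := Fmax x1 0 Qx1 D0; rewrite subr0 /m; lra.
have z0 : xh - y - h != 0.
  apply: contraTneq big => z0; rewrite z0 barrier0// subr0 -ltNge.
  have e : xh = y + h by apply/eqP; rewrite -subr_eq0 opprD addrA z0.
  by rewrite e; apply: (dP h Dh).1; rewrite -e.
(* On the boundary, the bound [ubd], changed by less than [m] through the shift, would contradict
   [big]. *)
have Oxh : Omega xh.
  apply: contrapT => nO.
  have /ubd : boundary Omega xh by split => // /interior_subset.
  by have := (dP h Dh).2 xh Qxh; lra.
have s0 : 0 < sqnorm (xh - (y + h)).
  by rewrite lt0r sqnorm_ge0 sqnorm_eq0 opprD addrA z0.
have b01 : 0 <= b <= 1 by apply/andP; split; lra.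
have [q [q0 q1 q2 qmaj]] := barrier_majorant A B b _ b01 A0 s0.
have g0 : grad (fun x => q.[sqnorm (x - (y + h))]) xh != 0.
  rewrite grad_radial scaler_eq0 negb_or mulf_eq0 pnatr_eq0/= q1.
  rewrite opprD addrA z0 andbT.
  (* At fixed [xh], the shift [h] minimizes the barrier over the cube. *)
  apply: barrier_minimizer_noncritical b02 A0 B0 d0 z0 Dh _ => h' Dh'.
  by have := Fmax xh h' Qxh Dh'; lra.
have := usub q (y + h) xh Oxh _ g0.
rewrite (p_laplacianN_barrier n2 np q1 q2 g0) opprK leNgt KB => H.
(* It remains to see that [u] minus the majorant has a local maximum at [xh]. *)
suff : false by []; apply: H.
near=> x.
have Qx : closure Omega x.
  by apply: subset_closure; near: x; exact: open_nbhs_nbhs.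
have sx : 0 < sqnorm (x - (y + h)).
  near: x.
  have := continuous_radial 'X (y + h) xh; rewrite /continuous_at hornerX.
  move=> /cvgr_gt /(_ 0 s0); apply: filterS => x; by rewrite hornerX.
have := Fmax x h Qx Dh; rewrite q0 => F.
have := qmaj _ sx; rewrite /barrier -!addrA -!opprD in F *.
by lra.
Unshelve. all: by end_near.
Qed.

(** * Null sets and the essential supremum *)

(* By induction on the dimension, integrating the slice inequality over the last
   coordinate; the weights [w] record which boxes meet the slice. *)
Lemma box_cover_volume {R : realType} (n : nat) (c d : nat -> R)
    (a b : nat -> nat -> R) (w : nat -> R) :
  (forall k, 0 <= w k) -> (forall i, (i < n)%N -> c i <= d i) ->
  (forall k i, (i < n)%N -> a k i <= b k i) ->
  (forall x : nat -> R, (forall i, (i < n)%N -> c i <= x i <= d i) ->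
    (1 <= \sum_(0 <= k <oo)
      (w k * \prod_(i < n) \1_[set` `[a k i, b k i]] (x i))%:E)%E) ->
  ((\prod_(i < n) (d i - c i))%:E <=
   \sum_(0 <= k <oo) (w k * \prod_(i < n) (b k i - a k i))%:E)%E.
Proof.
elim: n w => [|n IH] w w0 cd ab cover.
  (* In dimension 0 the covering inequality at any point is already the claim. *)
  have /= := cover (fun=> 0) (fun i => ltac:(by [])); rewrite !big_ord0.
  move=> /le_trans; apply; apply: lee_nneseries => k _ => [_|].
    by rewrite lee_fin big_ord0 mulr1.
  by rewrite !big_ord0.
pose Wk k : R := w k * \prod_(i < n) (b k i - a k i).
have Wk0 k : 0 <= Wk k.
  by rewrite mulr_ge0// prodr_ge0// => i _; rewrite subr_ge0 ab// ltnS ltnW.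
pose I k := [set` `[a k n, b k n]].
pose D := [set` `[c n, d n]].
have slice t : D t -> ((\prod_(i < n) (d i - c i))%:E <=
    \sum_(0 <= k <oo) ((Wk k)%:E * (\1_(I k) t)%:E))%E.
  rewrite /D/= in_itv/= => /andP[ct td].
  (* Box [k] keeps its weight only if its last side contains [t]. *)
  have := IH (fun k => w k * \1_(I k) t).
  under [X in (_ -> _ -> _ -> _ -> (_ <= X)%E) -> _]eq_eseriesr do
    rewrite mulrAC EFinM.
  apply.
  - by move=> k; rewrite mulr_ge0.
  - by move=> i ilt; apply: cd; rewrite ltnS ltnW.
  - by move=> k i ilt; apply: ab; rewrite ltnS ltnW.
  move=> x xb.
  have := cover (fun i => if i == n then t else x i) _.
  move=> /(_ _)/le_trans; apply.
    move=> i; rewrite ltnS leq_eqVlt; case: eqP => [-> _|_ /= ilt]; first by rewrite ct.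
    exact: xb.
  apply: lee_nneseries => k _ => [_|].
    by rewrite lee_fin mulr_ge0// prodr_ge0.
  rewrite lee_fin big_ord_recr/= eqxx.
  rewrite (eq_bigr (fun i : 'I_n => \1_[set` `[a k i, b k i]] (x i))); last first.
    by move=> i _; rewrite ltn_eqF.
  by rewrite [X in _ <= X]mulrAC -[X in _ <= X]mulrA.
have mI k : measurable (I k) by exact: measurable_itv.
have mD : measurable D by exact: measurable_itv.
pose g k (t : R) : \bar R := ((Wk k)%:E * (\1_(I k) t)%:E)%E.
have mterm k : measurable_fun D (g k).
  apply: measurable_funeM; apply/measurable_EFinP.
  exact: measurable_indic.
have term0 k t : (0 <= (Wk k)%:E * (\1_(I k) t)%:E)%E by rewrite -EFinM lee_fin mulr_ge0.
have mlen (l r : R) : l <= r -> lebesgue_measure [set` `[l, r]] = (r - l)%:E.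
  rewrite lebesgue_measure_itv/= lte_fin le_eqVlt => /orP[/eqP->|->//].
  by rewrite ltxx subrr.
have : (\int[lebesgue_measure]_(t in D) (\prod_(i < n) (d i - c i))%:E <=
    \int[lebesgue_measure]_(t in D)
      \sum_(0 <= k <oo) ((Wk k)%:E * (\1_(I k) t)%:E))%E.
  apply: ge0_le_integral => //.
  - move=> t _; rewrite lee_fin prodr_ge0// => i _.
    by rewrite subr_ge0 cd// ltnS ltnW.
  - by apply: (@ge0_emeasurable_sum _ _ _ D g predT) => k *; [exact: term0|exact: mterm].
rewrite integral_cst//= mlen ?cd// -EFinM big_ord_recr/=.
move=> /le_trans; apply.
rewrite integral_nneseries//; apply: lee_nneseries => k _ => [_|].
  by apply: integral_ge0 => t _; exact: term0.
rewrite ge0_integralZl_EFin//; last first.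
  by apply/measurable_EFinP; apply: measurable_indic; exact: mI.
have mIk := mI k.
rewrite integral_indic// big_ord_recr/= mulrA -/(Wk k) [X in (_ <= X)%E]EFinM.
apply: lee_wpmul2l; first by rewrite lee_fin.
(* Only the part of [I k] inside [D] is counted, at most the full side length. *)
rewrite -mlen ?ab//; apply: le_measure; rewrite ?inE//; exact: measurableI.
Qed.

(** A neighbourhood contains a closed cube of side [r], of volume [r ^ n]; nullity would cover it by
    boxes of total volume at most [r ^ n / 2]. *)
Lemma lebesgue_null_not_nbhs {R : realType} {n : nat} (N : set 'rV[R]_n)
    (x0 : 'rV[R]_n) :
  lebesgue_null N -> ~ nbhs x0 N.
Proof.
move=> N0 /nbhs_ballP[r /= r0 rN].
(* Row vectors are extended by 0 to sequences, the format in which the induction on the dimension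
   was carried out. *)
pose e (f : 'rV[R]_n) (i : nat) : R :=
  if (insub i : option 'I_n) is Some j then f 0 j else 0.
have eE f (j : 'I_n) : e f j = f 0 j by rewrite /e valK.
have v0 : 0 < r ^+ n by exact: exprn_gt0.
have [a [b [ab cov vol]]] := N0 (r ^+ n / 2) (divr_gt0 v0 (ltr0Sn R 1)).
pose c i := e x0 i - r / 2; pose d i := e x0 i + r / 2.
have vE : \prod_(i < n) (d i - c i) = r ^+ n.
  rewrite (eq_bigr (fun=> r)) ?prodr_const ?card_ord// => i _.
  by rewrite /d /c; lra.
have v2 : r ^+ n / 2 < r ^+ n by lra.
have := @box_cover_volume R n c d (fun k => e (a k)) (fun k => e (b k)) (fun=> 1).
rewrite vE => H.
suff : ((r ^+ n)%:E <= (r ^+ n / 2)%:E)%E by rewrite lee_fin leNgt v2.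
apply: le_trans (le_trans (H _ _ _ _) _) vol => {H}.
- by move=> k; exact: ler01.
- by move=> i _; rewrite /c /d; lra.
- by move=> k i ilt; rewrite -[i]/(val (Ordinal ilt)) !eE.
- move=> x xcd.
  have /rN/cov[k _ /= kx] : ball x0 r (\row_(i < n) x i).
    rewrite -ball_normE /=; rewrite (le_lt_trans (y := r / 2))//; last by lra.
    rewrite [leLHS]/Num.Def.normr/= mx_normrE; apply: bigmax_le; first by lra.
    move=> [i j] _ /=; rewrite !mxE ord1 -eE.
    by have := xcd j (ltn_ord j); rewrite /c /d ler_norml; lra.
  (* One box containing the point already contributes 1; the other terms are nonnegative. *)
  apply: le_trans (nneseries_lim_ge (P := predT) k.+1 _); last first.
    by move=> i _ _; rewrite lee_fin mul1r prodr_ge0.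
  rewrite big_nat_recr//= -[leLHS]add0e.
  apply: leeD; first by apply: sume_ge0 => i _; rewrite lee_fin mul1r prodr_ge0.
  rewrite lee_fin mul1r big1// => i _; rewrite !eE indicE mem_set//=.
  by have := kx i; rewrite mxE in_itv.
- apply: lee_nneseries => k _ => [_|]; rewrite lee_fin mul1r.
    by apply: prodr_ge0 => i _; rewrite subr_ge0 !eE.
  by rewrite le_eqVlt; apply/orP; left; apply/eqP/eq_bigr => i _; rewrite !eE.
Qed.

Lemma Linfty_norm_ge0 {R : realType} {n : nat} (A : set 'rV[R]_n) (f : 'rV[R]_n -> R) :
  (0 <= Linfty_norm A f)%E.
Proof. by apply: le_ereal_inf_tmp => M []. Qed.

(** If [|f x|] exceeded an admissible [M], continuity would make the set where [M < |f|] a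
    neighbourhood of [x], hence not null. *)
Lemma le_Linfty_norm {R : realType} {n : nat} (A : set 'rV[R]_n)
    (f : 'rV[R]_n -> R) (x : 'rV[R]_n) :
  open A -> {within A, continuous f} -> A x -> (`|f x|%:E <= Linfty_norm A f)%E.
Proof.
move=> oA cf Ax; rewrite leNgt; apply/negP => /ereal_inf_lt[M [M0 nullM] Mf].
apply: lebesgue_null_not_nbhs nullM _ => /=.
have cfx : {for x, continuous f}.
  by move: cf; rewrite continuous_open_subspace// => /(_ x); apply; rewrite inE.
case: M M0 Mf => [M||] //= M0; rewrite lte_fin => Mf.
have cn : {for x, continuous (fun y => `|f y|)}.
  by apply: (@continuous_comp _ _ _ f Num.norm) => //; exact: norm_continuous.
have near_f : \forall y \near x, M < `|f y| by exact: cvgr_gt cn M Mf.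
have nA : nbhs x A by exact: open_nbhs_nbhs.
by apply: filterS (filterI nA near_f) => y [Ay fy]; split.
Qed.

(** * Boundary and diameter of a bounded domain *)

Lemma compact_closure_bounded {R : realType} {n : nat} {A : set 'rV[R]_n} :
  bounded_set A -> compact (closure A).
Proof.
move=> /ex_strict_bound_gt0[M M0 AM].
apply: bounded_closed_compact; last exact: closed_closure.
exists M; split; first exact: num_real.
move=> N MN x Ax /=; rewrite leNgt; apply/negP => Nx.
have nx : \forall y \near x, N < `|y| by exact: cvgr_gt (@norm_continuous _ _ x) N Nx.
have [y [Ay /= Ny]] := Ax _ nx.
by have := AM _ Ay; rewrite /= ltNge (ltW (lt_trans MN Ny)).
Qed.

Lemma enorm_gt0 {R : realType} {n : nat} (x : 'rV[R]_n) : x != 0 -> 0 < enorm x.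
Proof.
move=> x0; rewrite /enorm sqrtr_gt0 -/(sqnorm x).
by rewrite lt0r sqnorm_ge0 sqnorm_eq0 x0.
Qed.

Lemma sqnormE {R : realType} {n : nat} (x : 'rV[R]_n) : sqnorm x = enorm x ^+ 2.
Proof. by rewrite /enorm sqr_sqrtr// sqnorm_ge0. Qed.

Lemma sqnorm_powR {R : realType} {n : nat} (c : R) (x : 'rV[R]_n) :
  sqnorm x `^ (c / 2) = enorm x `^ c.
Proof.
have e0 : 0 <= enorm x by exact: sqrtr_ge0.
by rewrite sqnormE -powR_mulrn// -powRrM mulrC divfK.
Qed.

Lemma enormBC {R : realType} {n : nat} (x y : 'rV[R]_n) : enorm (x - y) = enorm (y - x).
Proof.
by rewrite /enorm; congr Num.sqrt; apply: eq_bigr => i _; rewrite !mxE -sqrrN opprB.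
Qed.

Lemma continuous_enormB {R : realType} {n : nat} :
  continuous (fun xy : 'rV[R]_n * 'rV[R]_n => enorm (xy.1 - xy.2)).
Proof.
move=> xy; apply: (@continuous_comp _ _ _
  (fun xy : 'rV[R]_n * 'rV[R]_n => sqnorm (xy.1 - xy.2)) Num.sqrt);
  last exact: sqrt_continuous.
apply: continuous_cvg; first exact: continuous_sqnorm.
by apply: cvgB; [exact: cvg_fst|exact: cvg_snd].
Qed.

(** Two closure points further apart than the diameter would have points of [A] nearby that are also
    too far apart. *)
Lemma enorm_le_diam {R : realType} {n : nat} {A : set 'rV[R]_n} {x y : 'rV[R]_n} :
  bounded_set A -> closure A x -> closure A y -> enorm (x - y) <= diam A.
Proof.
move=> bA Ax Ay; rewrite leNgt; apply/negP => dxy.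
have cA := compact_closure_bounded bA.
have near_xy : \forall z \near (x, y), diam A < enorm (z.1 - z.2).
  exact: cvgr_gt (continuous_enormB (x, y)) _ dxy.
case: near_xy => -[U V] /= [Ux Vy] UV.
have [x' [Ax' Ux']] := Ax _ Ux.
have [y' [Ay' Vy']] := Ay _ Vy.
have := UV (x', y') (conj Ux' Vy'); rewrite ltNge => /negP; apply.
(* Compactness bounds the distances, so that [sup] is a genuine upper bound. *)
have [|[a b] _ ab] := compact_EVT_max _ (compact_setX cA cA)
    (continuous_subspaceT continuous_enormB).
  by exists (x, y).
apply: ub_le_sup; last by exists x', y'.
exists (enorm (a - b)) => _ [s [t [As At ->]]].
by apply: (ab (s, t)); rewrite inE; split; exact: subset_closure.
Qed.

(** From an interior point, a small move along coordinate [i] in the direction of the sign of [k]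
    would increase [k * x 0 i]. The factor [k] covers maxima and minima at once. *)
Lemma extremal_coord_boundary {R : realType} {n : nat} (A : set 'rV[R]_n)
    (i : 'I_n) (k : R) (x : 'rV[R]_n) :
  k != 0 -> closure A x ->
  (forall y, closure A y -> k * y 0 i <= k * x 0 i) -> boundary A x.
Proof.
move=> k0 Ax xmax; split => // Aox.
have near_t : \forall t \near (0 : R), A (x + t *: delta_mx 0 i).
  have c : (x + t *: delta_mx 0 i) @[t --> (0 : R)] --> x.
    rewrite -[X in _ --> X]addr0 -[X in _ + X](scale0r (delta_mx 0 i)).
    apply: (@continuousD _ _ _ (cst x) (fun t : R => t *: delta_mx 0 i)).
      exact: cst_continuous.
    exact: scalel_continuous.
  exact: c Aox.
move/nbhs_ballP : near_t => [e /= e0 eA].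
pose t := e / 2 * Num.sg k.
have te : ball (0 : R) e t.
  rewrite /ball/= sub0r normrN normrM normr_sg k0 mulr1 ger0_norm; lra.
have At : A (x + t *: delta_mx 0 i) by exact: eA _ te.
have := xmax _ (subset_closure At).
rewrite !mxE !eqxx /= mulr1 mulrDr gerDl /t mulrCA [k * _]mulrC -normrEsg.
by rewrite leNgt mulr_gt0 ?normr_gt0// divr_gt0.
Qed.

(** Extremal points of a coordinate lie on the boundary. If they coincided, the coordinate would be
    constant on the closure, making the point [a] of the open set a boundary point. *)
Lemma boundary_two_points {R : realType} {n : nat} {A : set 'rV[R]_n} :
  (0 < n)%N -> bounded_domain A ->
  exists x y, [/\ boundary A x, boundary A y & x != y].
Proof.
move=> n0 [oA _ [a Aa] bA].
have cA := compact_closure_bounded bA.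
have A0 : closure A !=set0 by exists a; exact: subset_closure.
pose i := Ordinal n0.
have ci : {within closure A, continuous (fun x : 'rV[R]_n => x 0 i)}.
  by apply: continuous_subspaceT; exact: coord_continuous.
have [x /set_mem Ax xmax] := compact_EVT_max A0 cA ci.
have [y /set_mem Ay ymin] := compact_EVT_min A0 cA ci.
exists x, y; split.
- apply: (extremal_coord_boundary A i 1) => // z Az.
  by rewrite !mul1r; apply: xmax; rewrite inE.
- apply: (extremal_coord_boundary A i (- 1)) => // z Az.
  by rewrite !mulN1r lerN2; apply: ymin; rewrite inE.
- apply/eqP => exy.
  have Aca : closure A a by exact: subset_closure.
  have : boundary A a.
    apply: (extremal_coord_boundary A i 1) => // z Az; rewrite !mul1r.
    apply: le_trans (ymin a _); last by rewrite inE.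
    by rewrite -exy; apply: xmax; rewrite inE.
  by case=> _; apply; exact: open_nbhs_nbhs.
Qed.

(** Two distinct points keep the supremum from ranging over the empty set, where it is [-oo]. *)
Lemma holder_seminorm_ge0 {R : realType} {n : nat} (c : R) (A : set 'rV[R]_n)
    (g : 'rV[R]_n -> R) :
  (exists x y, [/\ A x, A y & x != y]) -> (0 <= holder_seminorm c A g)%E.
Proof.
move=> [x [y [Ax Ay xy]]].
apply: (@le_trans _ _ (`|g x - g y| / (enorm (x - y) `^ c))%:E).
  by rewrite lee_fin divr_ge0// powR_ge0.
by apply: ereal_sup_ubound; exists x, y.
Qed.

Lemma le_holder_seminorm {R : realType} {n : nat} {c H : R} {A : set 'rV[R]_n}
    {g : 'rV[R]_n -> R} {x y : 'rV[R]_n} :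
  holder_seminorm c A g = H%:E -> 0 <= H -> A x -> A y ->
  `|g x - g y| <= H * enorm (x - y) `^ c.
Proof.
move=> gH H0 Ax Ay; have [->|xy] := eqVneq x y.
  by rewrite subrr normr0 mulr_ge0 ?powR_ge0.
have e0 : 0 < enorm (x - y) `^ c by rewrite powR_gt0// enorm_gt0// subr_eq0.
rewrite -ler_pdivrMr// -lee_fin -gH.
by apply: ereal_sup_ubound; exists x, y.
Qed.

(** * Hoelder estimates *)

(** Despite the normalization, at a noncritical point of a radial polynomial the operator is linear
    in the derivatives of [q]. *)
Lemma p_laplacianN_radialN {R : realType} {n : nat} {p : \bar R} {q : {poly R}}
    {z x : 'rV[R]_n} :
  grad (fun y => q.[sqnorm (y - z)]) x != 0 ->
  p_laplacianN p (fun y => (- q).[sqnorm (y - z)]) x =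
  - p_laplacianN p (fun y => q.[sqnorm (y - z)]) x.
Proof.
move=> g0; have gN0 : grad (fun y => (- q).[sqnorm (y - z)]) x != 0.
  by move: g0; rewrite !grad_radial derivN hornerN mulrN scaleNr oppr_eq0.
rewrite /p_laplacianN /p_combine !inf_laplacianN_radial// !laplacian_radial.
by rewrite !derivN !hornerN; case: p => [r||]; ring.
Qed.

Lemma viscosity_radial_subsolution {R : realType} {n : nat} {p : \bar R}
    {Omega : set 'rV[R]_n} {f u : 'rV[R]_n -> R} {K : R} :
  viscosity_subsolution p Omega f u -> (forall x, Omega x -> f x <= K) ->
  radial_subsolution p Omega K u.
Proof.
move=> usub fK q z x0 phi Ox0 umax g0; apply: le_trans (fK _ Ox0).
exact: (usub x0 phi Ox0 (C2_on_radial _ _ _) umax).1.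
Qed.

(** A test polynomial [q] touching [- u] from above gives [- q] touching [u] from below. *)
Lemma viscosity_radial_supersolution {R : realType} {n : nat} {p : \bar R}
    {Omega : set 'rV[R]_n} {f u : 'rV[R]_n -> R} {K : R} :
  viscosity_supersolution p Omega f u -> (forall x, Omega x -> - f x <= K) ->
  radial_subsolution p Omega K (- u).
Proof.
move=> usup fK q z x0 phi Ox0 umax g0; apply: le_trans (fK _ Ox0).
have gN0 : grad (fun y => (- q).[sqnorm (y - z)]) x0 != 0.
  by move: g0; rewrite /phi !grad_radial derivN hornerN mulrN scaleNr oppr_eq0.
rewrite -(opprK (p_laplacianN _ _ _)) lerN2 -p_laplacianN_radialN// -lerN2 opprK.
rewrite lerNr.
apply: (usup x0 _ Ox0 (C2_on_radial _ _ _) _).1 => //.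
apply: filterS umax => x; rewrite /phi !hornerN /=.
by rewrite -[(- u) x]/(- u x) -[(- u) x0]/(- u x0); lra.
Qed.

(** On the boundary [|z - y| ^ 2 <= diam ^ (1 + alpha) * |z - y| ^ (1 - alpha)], so the barrier with
    [A = H + B * diam ^ (1 + alpha)] dominates the given bound. In the conclusion its negative
    quadratic term is dropped. *)
Lemma holder_boundary_to_interior {R : realType} {n : nat} {p : \bar R}
    {Omega : set 'rV[R]_n} {u : 'rV[R]_n -> R} {K B H : R} {y : 'rV[R]_n} :
  (2 <= n)%N -> (n%:R%:E < p)%E -> bounded_domain Omega ->
  {within closure Omega, continuous u} ->
  radial_subsolution p Omega K u ->
  0 <= H -> 0 < B -> K < 2 * B / C_ n p -> closure Omega y ->
  (forall x, boundary Omega x ->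
    u x - u y <= H * enorm (x - y) `^ (1 - alpha_ n p)) ->
  forall x, closure Omega x ->
    u x - u y <= (H + B * diam Omega `^ (1 + alpha_ n p))
                 * enorm (x - y) `^ (1 - alpha_ n p).
Proof.
move=> n2 np [oO _ _ bO] cu usub H0 B0 KB Qy ubd x Qx.
have /andP[a0 a1] := alpha_bounds n2 np.
set a := alpha_ n p in a0 a1 ubd *.
set A := H + _.
have A0 : 0 <= A by rewrite addr_ge0// mulr_ge0 ?powR_ge0// ltW.
have bE z : barrier A B ((1 - a) / 2) (z - y) =
    A * enorm (z - y) `^ (1 - a) - B * enorm (z - y) ^+ 2.
  by rewrite /barrier sqnorm_powR sqnormE.
apply: le_trans (barrier_comparison n2 np oO (compact_closure_bounded bO) cu usub
  A0 B0 KB Qy _ x Qx) _ => [z bz|]; last first.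
  by rewrite bE gerBl mulr_ge0 ?sqr_ge0// ltW.
rewrite bE; apply: le_trans (ubd z bz) _.
rewrite /A mulrDl -addrA lerDl subr_ge0 -mulrA ler_wpM2l ?(ltW B0)//.
have e0 : 0 <= enorm (z - y) by exact: sqrtr_ge0.
have eD : enorm (z - y) <= diam Omega by apply: enorm_le_diam => //; case: bz.
rewrite -powR_mulrn// (_ : 2%:R = (1 + a) + (1 - a)); last by lra.
rewrite powRD; last by apply/implyP => /eqP; lra.
rewrite ler_wpM2r ?powR_ge0//; apply: ge0_ler_powR => //; first by lra.
by rewrite nnegrE (le_trans e0).
Qed.

Lemma holder_estimate {R : realType} {n : nat} {p : \bar R}
    {Omega : set 'rV[R]_n} {u : 'rV[R]_n -> R} {K B H : R} :
  (2 <= n)%N -> (n%:R%:E < p)%E -> bounded_domain Omega ->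
  {within closure Omega, continuous u} ->
  radial_subsolution p Omega K u -> radial_subsolution p Omega K (- u) ->
  0 <= H -> 0 < B -> K < 2 * B / C_ n p ->
  (forall x y, boundary Omega x -> boundary Omega y ->
    `|u x - u y| <= H * enorm (x - y) `^ (1 - alpha_ n p)) ->
  forall x y, closure Omega x -> closure Omega y ->
    `|u x - u y| <= (H + 2 * B * diam Omega `^ (1 + alpha_ n p))
                    * enorm (x - y) `^ (1 - alpha_ n p).
Proof.
move=> n2 np bO cu usub uNsub H0 B0 KB ubd.
have cNu : {within closure Omega, continuous (- u)}.
  by move=> x; apply: continuousN; exact: cu.
set D := diam Omega `^ _.
(* Applied to [u] and to [- u], the one-sided estimate becomes two-sided. *)
have step H' y : 0 <= H' -> closure Omega y ->
    (forall x, boundary Omega x ->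
      `|u x - u y| <= H' * enorm (x - y) `^ (1 - alpha_ n p)) ->
    forall x, closure Omega x ->
      `|u x - u y| <= (H' + B * D) * enorm (x - y) `^ (1 - alpha_ n p).
  move=> H'0 Qy h x Qx; rewrite ler_norml; apply/andP; split.
    rewrite lerNl.
    have NuE z : (- u) z - (- u) y = - (u z - u y) by rewrite opprB opprK addrC.
    rewrite -NuE.
    apply: (holder_boundary_to_interior n2 np bO cNu uNsub H'0 B0 KB Qy) => // z bz.
    by rewrite NuE; apply: le_trans (h z bz); rewrite -normrN; exact: ler_norm.
  apply: (holder_boundary_to_interior n2 np bO cu usub H'0 B0 KB Qy) => // z bz.
  by apply: le_trans (h z bz); exact: ler_norm.
have D0 : 0 <= B * D by rewrite mulr_ge0 ?powR_ge0// ltW.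
move=> x y Qx Qy.
rewrite (_ : H + 2 * B * D = H + B * D + B * D); last by ring.
apply: (step) => // [|z bz]; first exact: addr_ge0.
(* The boundary data for the pole [y] come from a first round with pole [z], after exchanging the
   two arguments. *)
rewrite distrC enormBC; apply: (step) => //; first by case: bz.
by move=> w bw; exact: ubd.
Qed.

Theorem theorem5p4 (R : realType) (n : nat) (p : \bar R)
    (Omega : set 'rV[R]_n) (f g u : 'rV[R]_n -> R)
    (hn : (2 <= n)%N) (hp : (n%:R%:E < p)%E)
    (hOmega : bounded_domain Omega)
    (hf : {within Omega, continuous f})
    (hg : holder (1 - alpha_ n p) (boundary Omega) g)
    (hu : {within closure Omega, continuous u})
    (hsol : viscosity_solution p Omega f u)
    (hbd : forall x, boundary Omega x -> u x = g x) :
  forall x y : 'rV[R]_n, closure Omega x -> closure Omega y -> x != y ->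
    ((`|u x - u y| / (enorm (x - y) `^ (1 - alpha_ n p)))%:E
     <= (C_ n p)%:E * Linfty_norm Omega f * (diam Omega `^ (1 + alpha_ n p))%:E
        + holder_seminorm (1 - alpha_ n p) (boundary Omega) g)%E.
Proof.
move=> x y Qx Qy xy; have [oO _ _ bO] := hOmega.
have [_ usub usup] := hsol.
have C0 : 0 < C_ n p := C_gt0 hn hp.
have exy : 0 < enorm (x - y) by rewrite enorm_gt0// subr_eq0.
have D0 : 0 < diam Omega `^ (1 + alpha_ n p).
  by apply: powR_gt0; apply: lt_le_trans exy (enorm_le_diam bO Qx Qy).
have := holder_seminorm_ge0 (1 - alpha_ n p) _ g
  (boundary_two_points (ltnW hn) hOmega).
case E : holder_seminorm hg => [H||]; rewrite /holder E //.
rewrite lee_fin => _ H0.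
have fL z := le_Linfty_norm Omega f z oO hf.
(* If the norm of [f] is infinite, the right-hand side is [+oo]: the other factors are positive and
   [H] is finite. *)
case L : (Linfty_norm Omega f) (Linfty_norm_ge0 Omega f) => [K||] //; last first.
  move=> _; rewrite muleC muleA.
  rewrite gt0_muley ?mule_gt0 ?lte_fin//.
  rewrite addye// leey//.
rewrite lee_fin => K0; rewrite -!EFinM -EFinD lee_fin.
have fK z : Omega z -> `|f z| <= K by move=> Oz; rewrite -lee_fin -L; exact: fL.
have fleK z : Omega z -> f z <= K by move=> /fK; exact: le_trans (ler_norm _).
have fNleK z : Omega z -> - f z <= K.
  by move=> /fK; apply: le_trans; rewrite -normrN; exact: ler_norm.
set g0 := 1 - alpha_ n p; set D := diam Omega `^ _ in D0 *.
have e0 : 0 < enorm (x - y) `^ g0 by exact: powR_gt0.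
apply/ler_addgt0Pr => e e_gt0.
(* The excess [e / (2 * D)] makes [K < 2 * B / C_ n p] strict, while [2 * B * D] equals
   [C_ n p * K * D + e]. *)
pose B := C_ n p * K / 2 + e / (2 * D).
have B0 : 0 < B.
  by rewrite ltr_wpDl ?divr_gt0 ?mulr_gt0// divr_ge0// mulr_ge0// ltW.
have KB : K < 2 * B / C_ n p.
  rewrite ltr_pdivlMr// /B mulrDr (mulrC 2 (_ / 2)) divfK// (mulrC K) ltrDl.
  by rewrite mulr_gt0// divr_gt0// mulr_gt0.
rewrite ler_pdivrMr//.
apply: le_trans (holder_estimate hn hp hOmega hu
  (viscosity_radial_subsolution usub fleK)
  (viscosity_radial_supersolution usup fNleK) H0 B0 KB _ x y Qx Qy) _.
  move=> a b ba bb; rewrite !hbd//; exact: le_holder_seminorm E H0 ba bb.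
rewrite ler_wpM2r ?(ltW e0)// -/D /B le_eqVlt; apply/orP; left; apply/eqP.
by field; exact: lt0r_neq0.
Qed.
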